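(* Let $n\ge 4$ and let $(M,g,h)$ be a closed (compact, without boundary) $n$-dimensional spacelike manifold such that the symmetric tensor $h_{ij}$ is positive definite at every point of $M$. Then $M$ admits a hyperbolic metric, i.e. a Riemannian metric of constant negative sectional curvature.
   Context: Curvature convention: $R_{ijkl}$ denotes the Riemann curvature tensor with signs chosen so that the sectional curvature of the plane spanned by orthonormal vectors $e_i,e_j$ is $R_{ijij}$, that is, $R_{ijkl}=g(R(\partial_i,\partial_j)\partial_l,\partial_k)$ with $R(X,Y)Z=\nabla_X\nabla_YZ-\nabla_Y\nabla_XZ-\nabla_{[X,Y]}Z$. $\nabla$ is the Levi-Civita connection of $g$. A triple $(M,g_{ij},h_{ij})$ is called a spacelike manifold if $(M,g_{ij})$ is a Riemannian manifold and $h_{ij}$ is a symmetric $2$-tensor on $M$ satisfying the Gauss-Codazzi equations $$R_{ijkl}-(h_{il}h_{jk}-h_{ik}h_{jl})=0,\qquad \nabla_i h_{jk}-\nabla_j h_{ik}=0.$$ *)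

(* Defs.v *)
From mathcomp Require Import all_boot all_order all_algebra.
From mathcomp Require Import all_classical all_reals all_analysis.

Set Implicit Arguments.
Unset Strict Implicit.
Unset Printing Implicit Defensive.

Import Order.TTheory GRing.Theory Num.Theory.
Import numFieldNormedType.Exports.

Local Open Scope classical_set_scope.
Local Open Scope ring_scope.

Section Calculus.
Variables (R : realType) (n : nat).
Implicit Types (U : set 'rV[R]_n) (f : 'rV[R]_n -> R) (G H : 'rV[R]_n -> 'M[R]_n).

Definition pderiv (i : 'I_n) f : 'rV[R]_n -> R :=
  fun x => 'D_(delta_mx 0 i) f x.

(* C^oo on U, which is meant to be open: the partial derivatives of all orders
   exist and are continuous at the points of U. *)
Definition smooth_on U f :=
  forall s : seq 'I_n, let fs := foldr pderiv f s in
    forall x, U x ->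
      {for x, continuous fs} /\ forall i, derivable fs x (delta_mx 0 i).

Definition posdefmx (A : 'M[R]_n) :=
  forall v : 'rV[R]_n, v != 0 -> 0 < (v *m A *m v^T) 0 0.

(* Gamma^k_{ij} of the Levi-Civita connection of the metric G. *)
Definition christoffel G (k i j : 'I_n) : 'rV[R]_n -> R := fun x =>
  2^-1 * \sum_l invmx (G x) k l *
    (pderiv i (fun y => G y j l) x + pderiv j (fun y => G y i l) x
     - pderiv l (fun y => G y i j) x).

(* The coefficient of d_m in R(d_i, d_j) d_l, where
   R(X,Y)Z = nabla_X nabla_Y Z - nabla_Y nabla_X Z - nabla_[X,Y] Z. *)
Definition curv_op G (i j l m : 'I_n) : 'rV[R]_n -> R := fun x =>
  pderiv i (christoffel G m j l) x - pderiv j (christoffel G m i l) x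
  + \sum_p (christoffel G m i p x * christoffel G p j l x
            - christoffel G m j p x * christoffel G p i l x).

(* R_{ijkl} = g(R(d_i, d_j) d_l, d_k); the transposition of k and l makes
   R_{ijij} the sectional curvature when d_i, d_j are orthonormal. *)
Definition riemann G (i j k l : 'I_n) : 'rV[R]_n -> R := fun x =>
  \sum_m curv_op G i j l m x * G x m k.

(* (nabla_i H)_{jk} *)
Definition cov_deriv G H (i j k : 'I_n) : 'rV[R]_n -> R := fun x =>
  pderiv i (fun y => H y j k) x
  - \sum_l (christoffel G l i j x * H x l k + christoffel G l i k x * H x j l).

Definition inner G (x u v : 'rV[R]_n) : R := (u *m G x *m v^T) 0 0.

Definition sectional G (x u v : 'rV[R]_n) : R :=
  (\sum_i \sum_j \sum_k \sum_l
      riemann G i j k l x * u 0 i * v 0 j * u 0 k * v 0 l)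
  / (inner G x u u * inner G x v v - inner G x u v ^+ 2).

End Calculus.

Record chart (R : realType) (n : nat) (M : topologicalType) := Chart {
  chart_dom : set M;
  chart_map :> M -> 'rV[R]_n;
  chart_inv : 'rV[R]_n -> M;
  chart_dom_open : open chart_dom;
  chart_img_open : open (chart_map @` chart_dom);
  chart_mapK : {in chart_dom, cancel chart_map chart_inv};
  chart_map_continuous : {within chart_dom, continuous chart_map};
  chart_inv_continuous :
    {within chart_map @` chart_dom, continuous chart_inv} }.

Definition chart_img R n M (c : chart R n M) : set 'rV[R]_n :=
  c @` chart_dom c.

Definition overlap R n M (c d : chart R n M) : set 'rV[R]_n :=
  c @` (chart_dom c `&` chart_dom d).

Definition transition R n M (c d : chart R n M) : 'rV[R]_n -> 'rV[R]_n :=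
  d \o chart_inv c.

(* Manifolds without boundary: chart images are open in R^n. The smooth
   structure is given by an atlas, which need not be maximal. *)
Record smooth_manifold (R : realType) (n : nat) := SmoothManifold {
  carrier :> topologicalType;
  carrier_hausdorff : hausdorff_space carrier;
  carrier_second_countable : @second_countable carrier;
  chart_index : Type;
  atlas : chart_index -> chart R n carrier;
  atlas_cover : forall p, exists a, chart_dom (atlas a) p;
  atlas_smooth : forall a b (j : 'I_n),
    smooth_on (overlap (atlas a) (atlas b))
      (fun x => transition (atlas a) (atlas b) x 0 j) }.

(* Smooth covariant 2-tensor fields, by their components in the charts of the
   atlas. Vectors are rows, so that ('J psi x) i j = d_i psi^j and the
   transformation law is T_{ij} = d_i psi^k d_j psi^l T'_{kl}. Component
   functions are only meaningful on the images of the charts. *)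
Record tensor2 (R : realType) (n : nat) (M : smooth_manifold R n) := Tensor2 {
  comp :> chart_index M -> 'rV[R]_n -> 'M[R]_n;
  comp_smooth : forall a (i j : 'I_n),
    smooth_on (chart_img (atlas a)) (fun x => comp a x i j);
  comp_change : forall a b x, overlap (atlas a) (atlas b) x ->
    let psi := transition (atlas a) (atlas b) in
    comp a x = 'J psi x *m comp b (psi x) *m ('J psi x)^T }.

Section Geometry.
Variables (R : realType) (n : nat) (M : smooth_manifold R n).
Implicit Types (g h : tensor2 M).

Definition symmetric_tensor h :=
  forall a x, chart_img (atlas a) x -> (h a x)^T = h a x.

Definition positive_definite h :=
  forall a x, chart_img (atlas a) x -> posdefmx (h a x).

Definition riemannian g := symmetric_tensor g /\ positive_definite g.

Definition gauss_equation g h :=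
  forall a x, chart_img (atlas a) x -> forall i j k l : 'I_n,
    riemann (g a) i j k l x
    - (h a x i l * h a x j k - h a x i k * h a x j l) = 0.

Definition codazzi_equation g h :=
  forall a x, chart_img (atlas a) x -> forall i j k : 'I_n,
    cov_deriv (g a) (h a) i j k x - cov_deriv (g a) (h a) j i k x = 0.

Definition spacelike g h :=
  [/\ riemannian g, symmetric_tensor h, gauss_equation g h
    & codazzi_equation g h].

Definition constant_sectional g (c : R) :=
  forall a x, chart_img (atlas a) x -> forall u v : 'rV[R]_n,
    row_free (col_mx u v) -> sectional (g a) x u v = c.

Definition hyperbolic g :=
  riemannian g /\ exists2 c : R, c < 0 & constant_sectional g c.

End Geometry.

(* Main.v *)
(* The third fundamental form g' = h g^-1 h has constant curvature -1 (it is the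
   pullback of the hyperbolic metric by the Gauss map of a local spacelike
   immersion into Minkowski space). Let S = g^-1 h be the shape operator, so that
   g'(X, Y) = g(SX, SY). By the Codazzi equation the g'-compatible connection
   S^-1 o nabla o S is torsion free, hence it is the Levi-Civita connection of g',
   and its curvature is S^-1 R S. Substituting SZ and SW in the Gauss equation gives
   R'_{ijkl} = g'_{il} g'_{jk} - g'_{ik} g'_{jl}. *)
Require Import Defs.
From mathcomp Require Import all_boot all_order all_algebra.
From mathcomp Require Import all_classical all_reals all_analysis.
From mathcomp Require Import ring lra.

Set Implicit Arguments.
Unset Strict Implicit.
Unset Printing Implicit Defensive.

Import Order.TTheory GRing.Theory Num.Theory.
Import numFieldNormedType.Exports.

Local Open Scope classical_set_scope.
Local Open Scope ring_scope.

(** * Symmetry of mixed second directional derivatives *)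

Section SecondDerivatives.
Variables (R : realType) (V : normedModType R).
Implicit Types (f : V -> R) (x u v : V).

Lemma is_derive_line f x u (s : R) :
  derivable f (x + s *: u) u ->
  is_derive s 1 (fun r : R => f (x + r *: u)) ('D_u f (x + s *: u)).
Proof.
have E : (fun h : R => h^-1 *: (((fun r : R => f (x + r *: u)) \o shift s)
    (h *: (1 : R)) - f (x + s *: u))) =
  (fun h : R => h^-1 *: ((f \o shift (x + s *: u)) (h *: u) - f (x + s *: u))).
  apply/funext => h /=; congr (_ *: (f _ - _)).
  by rewrite [_ *: (1 : R)]mulr1 scalerDl addrCA.
by move=> df; apply: DeriveDef; rewrite /derivable/derive E.
Qed.

Lemma mean_value_line f x u (t : R) : 0 < t ->
  (forall s, 0 <= s <= t -> derivable f (x + s *: u) u) ->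
  exists2 s, 0 <= s <= t & f (x + t *: u) - f x = t * 'D_u f (x + s *: u).
Proof.
move=> t0 df.
have dl s : 0 <= s <= t ->
    is_derive s 1 (fun r : R => f (x + r *: u)) ('D_u f (x + s *: u)).
  by move=> /df; exact: is_derive_line.
have [||s st] := @MVT_segment R (fun r => f (x + r *: u))
    (fun r => 'D_u f (x + r *: u)) 0 t (ltW t0).
- by move=> s; rewrite in_itv /= => /andP[s0 st]; apply: dl; rewrite !ltW.
- apply: derivable_within_continuous => s; rewrite in_itv /= => st.
  exact: (@ex_derive _ _ _ _ _ _ _ (dl s st)).
- rewrite scale0r addr0 subr0 mulrC => ->; exists s => //.
Qed.

Definition second_difference f x u v (t : R) : R :=
  f (x + t *: u + t *: v) - f (x + t *: u) - (f (x + t *: v) - f x).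

Lemma second_differenceC f x u v t :
  second_difference f x u v t = second_difference f x v u t.
Proof. by rewrite /second_difference (addrAC x); ring. Qed.

(** Two applications of the mean value theorem, first along [u] and then along [v], turn the
    quotient into the value of ['D_v ('D_u f)] at some x + s u + w v with s and w in [0, t];
    continuity at [x] finishes. *)
Lemma second_difference_cvg f x u v :
  (\forall y \near x, derivable f y u /\ derivable ('D_u f) y v) ->
  {for x, continuous ('D_v ('D_u f))} ->
  forall e : R, 0 < e -> exists2 d : R, 0 < d & forall t : R, 0 < t < d ->
    `|second_difference f x u v t / t ^+ 2 - 'D_v ('D_u f) x| < e.
Proof.
move=> df cf e e0.
have : \forall y \near x, [/\ derivable f y u, derivable ('D_u f) y v &
    `|'D_v ('D_u f) y - 'D_v ('D_u f) x| < e].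
  near=> y.
  have [? ?] : derivable f y u /\ derivable ('D_u f) y v by near: y.
  split => //; near: y.
  exact: (cvgr_distC_lt ('D_v ('D_u f)) ('D_v ('D_u f) x) cf e e0).
move=> /nbhs_ballP[r /= r0 br].
(* The summand 1 keeps the divisor positive when [u] and [v] vanish. For t below the quotient, all
   points x + a u + b v with a, b in [0, t] stay in the ball of radius [r]. *)
have C0 : 0 < `|u| + `|v| + 1 by rewrite ltr_wpDl// addr_ge0.
exists (r / (`|u| + `|v| + 1)); first by rewrite divr_gt0.
move=> t /andP[t0]; rewrite ltr_pdivlMr// => tr.
have good a b : 0 <= a <= t -> 0 <= b <= t ->
   [/\ derivable f (x + a *: u + b *: v) u,
       derivable ('D_u f) (x + a *: u + b *: v) v &
    `|'D_v ('D_u f) (x + a *: u + b *: v) - 'D_v ('D_u f) x| < e].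
  move=> /andP[a0 at_] /andP[b0 bt]; apply: br; rewrite -ball_normE /=.
  rewrite -addrA opprD addNKr normrN; apply: le_lt_trans tr.
  rewrite (le_trans (ler_normD _ _))// !normrZ !ger0_norm// !mulrDr mulr1.
  have au : a * `|u| <= t * `|u| by rewrite ler_wpM2r.
  have bv : b * `|v| <= t * `|v| by rewrite ler_wpM2r.
  by move: au bv t0; lra.
have tt : 0 <= t <= t by rewrite lexx ltW.
have z0 : 0 <= (0 : R) <= t by rewrite lexx ltW.
(* The second difference is the increment of [phi] from x to x + t u. *)
pose phi y := f (y + t *: v) - f y.
have dphi s : 0 <= s <= t -> is_derive (x + s *: u) u phi
   ('D_u f (x + s *: u + t *: v) - 'D_u f (x + s *: u)).
  move=> st.
  have [d1 _ _] := good s t st tt; have [d2 _ _] := good s 0 st z0.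
  rewrite scale0r addr0 in d2.
  have i2 := derivableP d2.
  have E : (fun h : R => h^-1 *: (((fun y => f (y + t *: v)) \o shift (x + s *: u))
    (h *: u) - f (x + s *: u + t *: v))) =
    (fun h : R => h^-1 *: ((f \o shift (x + s *: u + t *: v)) (h *: u)
       - f (x + s *: u + t *: v))).
    by apply/funext => h /=; rewrite !addrA.
  have i1 : is_derive (x + s *: u) u (fun y => f (y + t *: v))
      ('D_u f (x + s *: u + t *: v)).
    by apply: DeriveDef; rewrite /derivable/derive E.
  exact: is_deriveB.
have [|s st] := @mean_value_line phi x u t t0.
  by move=> s st; exact: (@ex_derive _ _ _ _ _ _ _ (dphi s st)).
rewrite (@derive_val _ _ _ _ _ _ _ (dphi s st)) => E1.
have [|w wt E2] := @mean_value_line ('D_u f) (x + s *: u) v t t0.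
  by move=> w wt; have [] := good s w st wt.
rewrite /second_difference -[X in X / _]/(phi (x + t *: u) - phi x).
rewrite E1 E2 mulrA -expr2 mulrAC mulfV ?mul1r; last first.
  by rewrite expf_neq0// gt_eqF.
by have [] := good s w st wt.
Unshelve. all: by end_near. Qed.

(** Schwarz's theorem: the second difference is symmetric in [u] and [v], so its quotient by t^2 is
    close to both mixed derivatives for small t. *)
Lemma derive_comm f x u v :
  (\forall y \near x, [/\ derivable f y u, derivable f y v,
     derivable ('D_u f) y v & derivable ('D_v f) y u]) ->
  {for x, continuous ('D_v ('D_u f))} -> {for x, continuous ('D_u ('D_v f))} ->
  'D_v ('D_u f) x = 'D_u ('D_v f) x.
Proof.
move=> df cvu cuv.
have d1 : \forall y \near x, derivable f y u /\ derivable ('D_u f) y v.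
  by apply: filterS df => y [].
have d2 : \forall y \near x, derivable f y v /\ derivable ('D_v f) y u.
  by apply: filterS df => y [].
apply/eqP; rewrite -subr_eq0 -normr_le0; apply/ler_addgt0Pl => /= e0 e0p.
pose e : R := e0; have ep : 0 < e := e0p.
rewrite addr0 -/e.
have e2p : 0 < e / 2 by rewrite divr_gt0.
have [d d0 h1] := second_difference_cvg d1 cvu e2p.
have [d' d'0 h2] := second_difference_cvg d2 cuv e2p.
pose t := Num.min d d' / 2.
have t0 : 0 < t by rewrite divr_gt0// lt_min d0.
have tm : t < Num.min d d' by rewrite ltr_pdivrMr// ltr_pMr ?lt_min ?d0// ltr1n.
have td : 0 < t < d by rewrite t0 (lt_le_trans tm)// ge_min lexx.
have td' : 0 < t < d' by rewrite t0 (lt_le_trans tm)// ge_min lexx orbT.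
have a := h1 t td; have b := h2 t td'.
rewrite second_differenceC distrC in a.
rewrite (splitr e) (le_trans _ (ltW (ltrD a b)))//.
by rewrite (le_trans _ (ler_normD _ _))// addrA subrK.
Qed.

End SecondDerivatives.

(** * Closure properties of smooth functions on an open set *)

Section SmoothFunctions.
Variables (R : realType) (n : nat) (U : set 'rV[R]_n).
Hypothesis Uopen : open U.
Implicit Types (f g : 'rV[R]_n -> R) (i j : 'I_n) (x : 'rV[R]_n).

Lemma pderiv_eq_on f g i x : (forall y, U y -> f y = g y) -> U x ->
  pderiv i f x = pderiv i g x.
Proof.
move=> fg Ux; apply: near_eq_derive.
by apply: filterS (open_nbhs_nbhs (conj Uopen Ux)) => y /fg.
Qed.

Lemma smooth_on_continuous f x : smooth_on U f -> U x ->
  {for x, continuous f}.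
Proof. by move=> /(_ [::]) /= sf /sf[]. Qed.

Lemma smooth_on_derivable f i x : smooth_on U f -> U x ->
  derivable f x (delta_mx 0 i).
Proof. by move=> /(_ [::]) /= sf /sf[_]. Qed.

Lemma smooth_on_pderiv f i : smooth_on U f -> smooth_on U (pderiv i f).
Proof. by move=> sf s fs x Ux; have := sf (rcons s i) x Ux; rewrite foldr_rcons. Qed.

(* Closed under derivation up to equality on U, so all its members are smooth by
   induction on the order of derivation. *)
Inductive smooth_closure : ('rV[R]_n -> R) -> Prop :=
| closure_smooth f : smooth_on U f -> smooth_closure f
| closure_cst (a : R) : smooth_closure (fun=> a)
| closureD f g : smooth_closure f -> smooth_closure g ->
    smooth_closure (fun x => f x + g x)
| closureM f g : smooth_closure f -> smooth_closure g ->
    smooth_closure (fun x => f x * g x)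
| closureV f : smooth_closure f -> (forall x, U x -> f x != 0) ->
    smooth_closure (fun x => (f x)^-1).

Lemma closure_continuous f x : smooth_closure f -> U x ->
  {for x, continuous f}.
Proof.
move=> cf Ux; elim: {f} cf => [f sf|a|f g _ cf _ cg|f g _ cf _ cg|f _ cf f0].
- exact: smooth_on_continuous.
- exact: cst_continuous.
- exact: continuousD.
- exact: continuousM.
- by apply: continuousV => //; exact: f0.
Qed.

Lemma closure_derivable f i x : smooth_closure f -> U x ->
  derivable f x (delta_mx 0 i).
Proof.
move=> cf Ux; elim: {f} cf => [f sf|a|f g _ cf _ cg|f g _ cf _ cg|f _ cf f0].
- exact: smooth_on_derivable.
- exact: derivable_cst.
- exact: derivableD cf cg.
- exact: derivableM cf cg.
- by apply: derivableV => //; exact: f0.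
Qed.

Lemma closure_pderiv f i : smooth_closure f ->
  exists2 g, smooth_closure g & forall x, U x -> pderiv i f x = g x.
Proof.
elim=> {f} [f sf|a|f g cf [f' cf' ff'] cg [g' cg' gg']
           |f g cf [f' cf' ff'] cg [g' cg' gg']|f cf [f' cf' ff'] f0].
- by exists (pderiv i f) => //; apply/closure_smooth/smooth_on_pderiv.
- by exists (fun=> 0) => [|x _]; [exact: closure_cst|exact: derive_cst].
- exists (fun x => f' x + g' x) => [|x Ux]; first exact: closureD.
  rewrite -ff'// -gg'//; apply: deriveD; exact: closure_derivable.
- exists (fun x => f x * g' x + g x * f' x) => [|x Ux].
    by apply: closureD; exact: closureM.
  rewrite -ff'// -gg'//; apply: deriveM; exact: closure_derivable.
- exists (fun x => (-1) * ((f x)^-1 * (f x)^-1 * f' x)) => [|x Ux].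
    apply: closureM; first exact: closure_cst.
    by apply: closureM => //; apply: closureM; exact: closureV.
  rewrite -ff'// /pderiv deriveV//; [|exact: f0|exact: closure_derivable].
  by rewrite mulN1r -invfM -expr2 scaleNr.
Qed.

Lemma closure_smooth_on f g : smooth_closure g ->
  (forall x, U x -> f x = g x) -> smooth_on U f.
Proof.
move=> cg fg s fs x Ux; rewrite {}/fs.
(* The last entry of [s] is the derivative applied first. Removing it replaces [f] by [pderiv i f]
   and [g] by another member of the closure, hence the generalisation over both. *)
elim/last_ind: s f g cg fg => [|s i IH] f g cg fg; last first.
  rewrite foldr_rcons; have [g' cg' gg'] := closure_pderiv i cg.
  by apply: IH cg' _ => y Uy; rewrite -gg'//; exact: pderiv_eq_on.
have nfg : \forall y \near x, g y = f y.
  by apply: filterS (open_nbhs_nbhs (conj Uopen Ux)) => y /fg.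
split=> [|i] /=; last first.
  by apply: near_eq_derivable nfg _; exact: closure_derivable.
move: (closure_continuous cg Ux); rewrite /prop_for /continuous_at -fg//.
by move=> H; apply: cvg_trans H; exact: near_eq_cvg nfg.
Qed.

Lemma smooth_on_eq f g : smooth_on U g -> (forall x, U x -> f x = g x) ->
  smooth_on U f.
Proof. by move/closure_smooth; exact: closure_smooth_on. Qed.

Lemma smooth_on_cst (a : R) : smooth_on U (fun=> a).
Proof. by apply: closure_smooth_on (closure_cst a) _. Qed.

Lemma smooth_onD f g : smooth_on U f -> smooth_on U g ->
  smooth_on U (fun x => f x + g x).
Proof.
move=> sf sg; apply: (closure_smooth_on (g := fun x => f x + g x)) => //.
by apply: closureD; exact: closure_smooth.
Qed.

Lemma smooth_onM f g : smooth_on U f -> smooth_on U g ->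
  smooth_on U (fun x => f x * g x).
Proof.
move=> sf sg; apply: (closure_smooth_on (g := fun x => f x * g x)) => //.
by apply: closureM; exact: closure_smooth.
Qed.

Lemma smooth_onN f : smooth_on U f -> smooth_on U (fun x => - f x).
Proof.
move=> sf; apply: (@smooth_on_eq _ (fun x => -1 * f x)).
  exact: smooth_onM (smooth_on_cst _) sf.
by move=> x _; rewrite mulN1r.
Qed.

Lemma smooth_onV f : smooth_on U f -> (forall x, U x -> f x != 0) ->
  smooth_on U (fun x => (f x)^-1).
Proof.
move=> sf f0; apply: (closure_smooth_on (g := fun x => (f x)^-1)) => //.
by apply: closureV => //; exact: closure_smooth.
Qed.

Lemma smooth_on_sum (I : Type) (r : seq I) (P : pred I) (F : I -> 'rV[R]_n -> R) :
  (forall k, smooth_on U (F k)) ->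
  smooth_on U (fun x => \sum_(k <- r | P k) F k x).
Proof.
move=> sF; elim: r => [|k r IH].
  rewrite (_ : (fun _ => _) = fun=> 0); first exact: smooth_on_cst.
  by apply/funext => x; rewrite big_nil.
rewrite (_ : (fun _ => _) = fun x =>
  (if P k then F k x else 0) + \sum_(k <- r | P k) F k x).
  have sFk : smooth_on U (fun x => if P k then F k x else 0).
    by case: (P k); [exact: sF|exact: smooth_on_cst].
  exact: smooth_onD sFk IH.
by apply/funext => x; rewrite big_cons; case: (P k); rewrite ?add0r.
Qed.

Lemma smooth_on_prod (I : Type) (r : seq I) (F : I -> 'rV[R]_n -> R) :
  (forall k, smooth_on U (F k)) ->
  smooth_on U (fun x => \prod_(k <- r) F k x).
Proof.
move=> sF; elim: r => [|k r IH].
  rewrite (_ : (fun _ => _) = fun=> 1); first exact: smooth_on_cst.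
  by apply/funext => x; rewrite big_nil.
rewrite (_ : (fun _ => _) = fun x => F k x * \prod_(k <- r) F k x).
  exact: smooth_onM (sF k) IH.
by apply/funext => x; rewrite big_cons.
Qed.

(** * Smooth matrix-valued functions and their partial derivatives *)

Definition smooth_mx_on p q (A : 'rV[R]_n -> 'M[R]_(p, q)) :=
  forall a b, smooth_on U (fun x => A x a b).

Lemma smooth_det m (A : 'rV[R]_n -> 'M[R]_m) : smooth_mx_on A ->
  smooth_on U (fun x => \det (A x)).
Proof.
move=> sA; apply: smooth_on_sum => s.
apply: smooth_onM; [exact: smooth_on_cst|exact: smooth_on_prod].
Qed.

Lemma smooth_mulmx p q r (A : 'rV[R]_n -> 'M[R]_(p, q))
    (B : 'rV[R]_n -> 'M[R]_(q, r)) : smooth_mx_on A -> smooth_mx_on B ->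
  smooth_mx_on (fun x => A x *m B x).
Proof.
move=> sA sB a b.
rewrite (_ : (fun _ => _) = fun x => \sum_k A x a k * B x k b).
  by apply: smooth_on_sum => k; exact: smooth_onM.
by apply/funext => x; rewrite mxE.
Qed.

Lemma smooth_trmx p q (A : 'rV[R]_n -> 'M[R]_(p, q)) :
  smooth_mx_on A -> smooth_mx_on (fun x => (A x)^T).
Proof.
move=> sA a b; apply: smooth_on_eq (sA b a) _ => x _.
by rewrite mxE.
Qed.

Lemma smooth_adj m (A : 'rV[R]_n -> 'M[R]_m) : smooth_mx_on A ->
  smooth_mx_on (fun x => \adj (A x)).
Proof.
move=> sA a b; rewrite (_ : (fun _ => _) = fun x => cofactor (A x) b a).
  apply: smooth_onM; first exact: smooth_on_cst.
  apply: smooth_det => c d; rewrite (_ : (fun _ => _) =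
    fun x => A x (lift b c) (lift a d)); first exact: sA.
  by apply/funext => x; rewrite !mxE.
by apply/funext => x; rewrite mxE.
Qed.

Lemma smooth_invmx m (A : 'rV[R]_n -> 'M[R]_m) : smooth_mx_on A ->
  (forall x, U x -> A x \in unitmx) -> smooth_mx_on (fun x => invmx (A x)).
Proof.
move=> sA uA a b.
(* Cramer's formula. It is claimed on [U] only, because [invmx] returns a non-invertible matrix
   unchanged. *)
apply: (@smooth_on_eq _ (fun x => (\det (A x))^-1 * (\adj (A x)) a b)).
  apply: smooth_onM; last exact: smooth_adj.
  apply: smooth_onV; first exact: smooth_det.
  by move=> x /uA; rewrite unitmxE unitfE.
by move=> x /uA uAx; rewrite /invmx uAx mxE.
Qed.

Lemma pderivC f i j x : smooth_on U f -> U x ->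
  pderiv i (pderiv j f) x = pderiv j (pderiv i f) x.
Proof.
move=> sf Ux; apply: derive_comm.
- apply: filterS (open_nbhs_nbhs (conj Uopen Ux)) => y Uy.
  have [si sj] := (smooth_on_pderiv i sf, smooth_on_pderiv j sf).
  split; [exact: smooth_on_derivable sf Uy|exact: smooth_on_derivable sf Uy
         |exact: smooth_on_derivable sj Uy|exact: smooth_on_derivable si Uy].
- exact: smooth_on_continuous (smooth_on_pderiv i (smooth_on_pderiv j sf)) Ux.
- exact: smooth_on_continuous (smooth_on_pderiv j (smooth_on_pderiv i sf)) Ux.
Qed.

Definition pderivmx p q i (A : 'rV[R]_n -> 'M[R]_(p, q)) x : 'M[R]_(p, q) :=
  \matrix_(a, b) pderiv i (fun y => A y a b) x.

Lemma pderivmxE p q i (A : 'rV[R]_n -> 'M[R]_(p, q)) x a b :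
  pderivmx i A x a b = pderiv i (fun y => A y a b) x.
Proof. by rewrite mxE. Qed.

Lemma smooth_pderivmx p q i (A : 'rV[R]_n -> 'M[R]_(p, q)) :
  smooth_mx_on A -> smooth_mx_on (pderivmx i A).
Proof.
move=> sA a b; rewrite (_ : (fun _ => _) = pderiv i (fun y => A y a b)).
  exact/smooth_on_pderiv/sA.
by apply/funext => x; rewrite mxE.
Qed.

Lemma pderivmx_eq_on p q i (A B : 'rV[R]_n -> 'M[R]_(p, q)) x :
  (forall y, U y -> A y = B y) -> U x -> pderivmx i A x = pderivmx i B x.
Proof.
move=> AB Ux; apply/matrixP => a b; rewrite !mxE.
by apply: pderiv_eq_on => // y /AB ->.
Qed.

Lemma pderivmxD p q i (A B : 'rV[R]_n -> 'M[R]_(p, q)) x :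
  smooth_mx_on A -> smooth_mx_on B -> U x ->
  pderivmx i (fun y => A y + B y) x = pderivmx i A x + pderivmx i B x.
Proof.
move=> sA sB Ux; apply/matrixP => a b; rewrite !mxE.
rewrite /pderiv; have -> : (fun y => (A y + B y) a b) =
    (fun y => A y a b) + (fun y => B y a b) by apply/funext => y; rewrite mxE.
exact: deriveD (smooth_on_derivable (sA a b) Ux) (smooth_on_derivable (sB a b) Ux).
Qed.

Lemma pderivmxM p q r i (A : 'rV[R]_n -> 'M[R]_(p, q))
    (B : 'rV[R]_n -> 'M[R]_(q, r)) x :
  smooth_mx_on A -> smooth_mx_on B -> U x ->
  pderivmx i (fun y => A y *m B y) x =
  pderivmx i A x *m B x + A x *m pderivmx i B x.
Proof.
move=> sA sB Ux; apply/matrixP => a b; rewrite !mxE -big_split /=.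
rewrite /pderiv (_ : (fun y => _) =
  \sum_k ((fun y => A y a k) * (fun y => B y k b)) :> (_ -> R)); last first.
  by apply/funext => y; rewrite mxE fct_sumE.
have dA k : derivable (fun y => A y a k) x (delta_mx 0 i).
  exact: smooth_on_derivable.
have dB k : derivable (fun y => B y k b) x (delta_mx 0 i).
  exact: smooth_on_derivable.
rewrite derive_sum => [|k]; last exact: derivableM.
apply: eq_bigr => k _; rewrite deriveM// !pderivmxE addrC.
by congr (_ + _); exact: mulrC.
Qed.

Lemma pderivmx_tr p q i (A : 'rV[R]_n -> 'M[R]_(p, q)) x :
  pderivmx i (fun y => (A y)^T) x = (pderivmx i A x)^T.
Proof.
apply/matrixP => a b; rewrite !mxE.
by congr (pderiv _ _ _); apply/funext => y; rewrite mxE.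
Qed.

Lemma pderivmxC p q i j (A : 'rV[R]_n -> 'M[R]_(p, q)) x :
  smooth_mx_on A -> U x ->
  pderivmx i (pderivmx j A) x = pderivmx j (pderivmx i A) x.
Proof.
move=> sA Ux; apply/matrixP => a b.
have E k : (fun y => pderivmx k A y a b) = pderiv k (fun y => A y a b).
  by apply/funext => y; exact: pderivmxE.
by rewrite [LHS]pderivmxE [RHS]pderivmxE (E i) (E j); exact: pderivC (sA a b) Ux.
Qed.

End SmoothFunctions.

(** * The Levi-Civita connection and its curvature in matrix form *)

Section Connection.
Variables (R : realType) (n : nat).
Implicit Types (G H : 'rV[R]_n -> 'M[R]_n) (i j k l : 'I_n) (x : 'rV[R]_n).

(* Vectors are rows, so nabla_i v = d_i v + v *m connection G i. *)
Definition connection G i x : 'M[R]_n := \matrix_(l, k) christoffel G k i l x.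

(** The matrix by which R(d_i, d_j) acts on row vectors from the right; this is why the two products
    stand in the opposite order to the commutator [A_i, A_j] for column vectors. *)
Definition curvature G i j x : 'M[R]_n :=
  pderivmx i (connection G j) x - pderivmx j (connection G i) x
  + (connection G j x *m connection G i x - connection G i x *m connection G j x).

(** Twice the Christoffel symbols of the first kind, with the lowered index as column. *)
Definition lowered_christoffel G i x : 'M[R]_n :=
  \matrix_(j, l) (pderiv i (fun y => G y j l) x + pderiv j (fun y => G y i l) x
     - pderiv l (fun y => G y i j) x).

Lemma riemannE G i j k l x : riemann G i j k l x = (curvature G i j x *m G x) l k.
Proof.
rewrite /riemann mxE; apply: eq_bigr => m _; congr (_ * _).
rewrite /curv_op !mxE -sumrB; congr (_ - _ + _).
- by congr (pderiv _ _ _); apply/funext => y; rewrite mxE.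
- by congr (pderiv _ _ _); apply/funext => y; rewrite mxE.
- by apply: eq_bigr => p _; rewrite !mxE mulrC; congr (_ - _); exact: mulrC.
Qed.

Lemma cov_derivE G H i j k x : cov_deriv G H i j k x =
  (pderivmx i H x - (connection G i x *m H x + H x *m (connection G i x)^T)) j k.
Proof.
rewrite /cov_deriv !mxE big_split /=; congr (_ - (_ + _)).
- by apply: eq_bigr => p _; rewrite mxE.
- by apply: eq_bigr => p _; rewrite !mxE mulrC.
Qed.

Lemma connectionE G i x : (G x)^T = G x ->
  connection G i x = 2^-1 *: (lowered_christoffel G i x *m invmx (G x)).
Proof.
move=> sG; apply/matrixP => l k; rewrite !mxE; congr (_ * _).
apply: eq_bigr => p _; rewrite !mxE mulrC; congr (_ * _).
by rewrite -[in RHS]sG -trmx_inv mxE.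
Qed.

Variable U : set 'rV[R]_n.
Hypothesis Uopen : open U.

Lemma pderiv_sym G i a b x : (forall y, U y -> (G y)^T = G y) -> U x ->
  pderiv i (fun y => G y a b) x = pderiv i (fun y => G y b a) x.
Proof.
move=> sG Ux; apply: (pderiv_eq_on Uopen) => // y Uy.
by rewrite -{1}(sG y Uy) mxE.
Qed.

Lemma connection_torsion_free G i j l x :
  (forall y, U y -> (G y)^T = G y) -> U x ->
  connection G i x j l = connection G j x i l.
Proof.
move=> sG Ux; rewrite !mxE; congr (_ * _); apply: eq_bigr => k _.
by rewrite (pderiv_sym k i j sG Ux) [X in X - _]addrC.
Qed.

(** In the sum of [lowered_christoffel G i x] and its transpose, everything cancels except twice d_i
    G. *)
Lemma connection_metric G i x :
  (forall y, U y -> (G y)^T = G y) -> (forall y, U y -> G y \in unitmx) -> U x ->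
  pderivmx i G x = connection G i x *m G x + G x *m (connection G i x)^T.
Proof.
move=> sG uG Ux; rewrite -[in G x *m _](sG x Ux) -trmx_mul connectionE ?sG//.
rewrite -scalemxAl mulmxKV ?uG//; apply/matrixP => a b; rewrite !mxE.
by rewrite (pderiv_sym i b a sG Ux); field.
Qed.

(** Koszul's argument, at the single point [x]. Compatibility writes d_k G as [W k *m G x] plus its
    transpose, and the entries (W_a G)_{bc} are symmetric in a, b; the Koszul combination of
    derivatives therefore collapses to 2 W_i G. *)
Lemma connection_unique G x (W : 'I_n -> 'M[R]_n) :
  (G x)^T = G x -> G x \in unitmx ->
  (forall i j l, W i j l = W j i l) ->
  (forall i, pderivmx i G x = W i *m G x + G x *m (W i)^T) ->
  forall i, connection G i x = W i.
Proof.
move=> sG uG tW mW i.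
have dG k a b : pderiv k (fun y => G y a b) x =
    (W k *m G x) a b + (W k *m G x) b a.
  by rewrite -pderivmxE mW -[in G x *m _]sG -trmx_mul !mxE.
have tWG a b c : (W a *m G x) b c = (W b *m G x) a c.
  by rewrite !mxE; apply: eq_bigr => k _; rewrite tW.
rewrite connectionE// (_ : lowered_christoffel G i x = 2 *: (W i *m G x)).
  by rewrite -scalemxAl mulmxK// scalerA mulVf ?scale1r// pnatr_eq0.
apply/matrixP => a b; rewrite [LHS]mxE !dG [RHS]mxE.
rewrite (tWG a i b) (tWG b i a) (tWG b a i); ring.
Qed.

Lemma smooth_connection G i : smooth_mx_on U G ->
  (forall y, U y -> G y \in unitmx) -> smooth_mx_on U (connection G i).
Proof.
move=> sG uG a b; 
apply: (@smooth_on_eq _ _ _ Uopen _ (christoffel G b i a)); last first.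
  by move=> x _; rewrite mxE.
apply: (smooth_onM Uopen); first exact: smooth_on_cst.
apply: (smooth_on_sum Uopen) => l; apply: (smooth_onM Uopen).
  exact: smooth_invmx.
apply: (smooth_onD Uopen); first by apply: (smooth_onD Uopen); exact: smooth_on_pderiv.
by apply: (smooth_onN Uopen); exact: smooth_on_pderiv.
Qed.

End Connection.

(* Transformation of the curvature under S: W_i = (d_i S + S A_i) S^-1, with a, b
   for d_i S, d_j S and P for d_i d_j S = d_j d_i S. *)
Lemma gauge_curvature (R : comPzRingType) n
    (S P a b Ai Aj dAij dAji Wi Wj dWij dWji : 'M[R]_n) :
  Wi *m S = a + S *m Ai -> Wj *m S = b + S *m Aj ->
  dWij *m S = P + a *m Aj + S *m dAij - Wj *m a ->
  dWji *m S = P + b *m Ai + S *m dAji - Wi *m b ->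
  (dWij - dWji + (Wj *m Wi - Wi *m Wj)) *m S =
  S *m (dAij - dAji + (Aj *m Ai - Ai *m Aj)).
Proof.
move=> Ei Ej Eij Eji.
rewrite mulmxDl !mulmxBl Eij Eji -!mulmxA Ei Ej !mulmxDr !mulmxN !mulmxA Ei Ej.
rewrite !mulmxDl.
move: (Wj *m a) (Wi *m b) (a *m Aj) (b *m Ai) (S *m dAij) (S *m dAji).
move: (S *m Aj *m Ai) (S *m Ai *m Aj) => m1 m2 m3 m4 m5 m6 m7 m8.
by apply/matrixP => k l; rewrite !mxE; ring.
Qed.

(** * Connection and curvature of the third fundamental form *)

Section ThirdFundamentalForm.
Variables (R : realType) (n : nat) (U : set 'rV[R]_n).
Variables G H S III : 'rV[R]_n -> 'M[R]_n.
Hypotheses (Uopen : open U) (smoothG : smooth_mx_on U G) (smoothS : smooth_mx_on U S).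
Hypothesis symG : forall x, U x -> (G x)^T = G x.
Hypothesis unitG : forall x, U x -> G x \in unitmx.
Hypothesis unitS : forall x, U x -> S x \in unitmx.
Hypothesis SG : forall x, U x -> S x *m G x = H x.
Hypothesis IIIE : forall x, U x -> III x = S x *m G x *m (S x)^T.

Lemma smooth_III : smooth_mx_on U III.
Proof.
move=> a b; have sSG := smooth_mulmx Uopen smoothS smoothG.
apply: (smooth_on_eq Uopen (smooth_mulmx Uopen sSG (smooth_trmx Uopen smoothS) a b)).
by move=> x /IIIE ->.
Qed.

Lemma trmx_III x : U x -> (III x)^T = III x.
Proof. by move=> Ux; rewrite IIIE// !trmx_mul trmxK symG// mulmxA. Qed.

Lemma unit_III x : U x -> III x \in unitmx.
Proof. by move=> Ux; rewrite IIIE// !unitmx_mul unitmx_tr unitS// unitG. Qed.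

Hypothesis codazzi : forall x, U x -> forall i j k,
  cov_deriv G H i j k x = cov_deriv G H j i k x.

Local Notation A := (connection G).

(* nabla_i (v *m S) = d_i v *m S + v *m shape_deriv i. *)
Definition shape_deriv i x := pderivmx i S x + S x *m A i x.

(** Since H = S G and G is parallel, nabla_i H = (nabla_i S) G. The matrix of nabla_i S is
    [shape_deriv i x - A i x *m S x], the commutator of nabla_i with right multiplication by S. *)
Lemma pderivmx_SG i x : U x ->
  pderivmx i H x - (A i x *m H x + H x *m (A i x)^T) =
  (shape_deriv i x - A i x *m S x) *m G x.
Proof.
move=> Ux.
have -> : pderivmx i H x = pderivmx i (fun y => S y *m G y) x.
  by apply: (pderivmx_eq_on Uopen) => // y /SG.
rewrite (pderivmxM _ smoothS smoothG Ux) (connection_metric Uopen i symG unitG Ux).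
rewrite -SG// mulmxBl mulmxDl mulmxDr !mulmxA.
move: (pderivmx i S x *m _) (S x *m _ *m _) (A i x *m _ *m _) (_ *m _^T) => a b c d.
by apply/matrixP => k l; rewrite !mxE; ring.
Qed.

(** The Codazzi equation makes nabla S symmetric once the invertible factor G is cancelled; the
    remaining term A S is symmetric because [connection G] is torsion free. *)
Lemma shape_deriv_torsion_free i j l x : U x ->
  shape_deriv i x j l = shape_deriv j x i l.
Proof.
move=> Ux.
(* [X a] stands for nabla_a S; the existential hides its body from later rewriting. *)
have [X XE] : exists X, forall a, X a = shape_deriv a x - A a x *m S x by eexists.
have XG a : pderivmx a H x - (A a x *m H x + H x *m (A a x)^T) = X a *m G x.
  by rewrite pderivmx_SG// XE.
have derivE a : shape_deriv a x = X a + A a x *m S x by rewrite XE subrK.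
have codazziX k : (X i *m G x) j k = (X j *m G x) i k.
  rewrite -(XG i) -(XG j).
  by have := codazzi Ux i j k; rewrite !cov_derivE.
have : row j (X i) = row i (X j).
  apply: (can_inj (mulmxK (unitG Ux))); rewrite -!row_mul.
  by apply/rowP => k; rewrite mxE codazziX [RHS]mxE.
move=> /rowP/(_ l); rewrite mxE [in RHS]mxE => Xij.
rewrite !derivE mxE [RHS]mxE Xij mxE [in RHS]mxE; congr (_ + _).
by apply: eq_bigr => p _; rewrite (connection_torsion_free Uopen i j p symG Ux).
Qed.

(** On rows, S^-1 o nabla_i o S is d_i plus right multiplication by
    [shape_deriv i x *m invmx (S x)]. This family is torsion free by the previous lemma and
    compatible with III = S G S^T by the product rule, so [connection_unique] applies. *)
Lemma connection_III i x : U x -> connection III i x *m S x = shape_deriv i x.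
Proof.
move=> Ux.
rewrite (@connection_unique _ _ III x (fun i => shape_deriv i x *m invmx (S x)));
  [by rewrite mulmxKV// unitS|exact: trmx_III|exact: unit_III| |].
- move=> a b l; move: (fun k => shape_deriv_torsion_free a b k Ux).
  move: (shape_deriv a x) (shape_deriv b x) => Da Db Dab.
  by rewrite mxE [RHS]mxE; apply: eq_bigr => k _; rewrite Dab.
move=> {}i.
have -> : pderivmx i III x = pderivmx i (fun y => S y *m G y *m (S y)^T) x.
  by apply: (pderivmx_eq_on Uopen) => // y /IIIE.
rewrite (pderivmxM _ (smooth_mulmx Uopen smoothS smoothG) (smooth_trmx Uopen smoothS) Ux).
rewrite (pderivmxM _ smoothS smoothG Ux) (connection_metric Uopen i symG unitG Ux).
rewrite pderivmx_tr -[in III x *m _](trmx_III Ux) -trmx_mul IIIE//.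
rewrite !mulmxA mulmxKV ?unitS// !trmx_mul trmxK symG// /shape_deriv.
rewrite [(_ + _)^T]linearD /= trmx_mul !mulmxDl !mulmxDr !mulmxDl !mulmxA -!addrA.
by congr (_ + (_ + _)); rewrite addrC.
Qed.

Lemma curvature_III i j x : U x ->
  curvature III i j x *m S x = S x *m curvature G i j x.
Proof.
move=> Ux.
have smoothA a : smooth_mx_on U (A a) by exact: smooth_connection.
have smoothA' a : smooth_mx_on U (connection III a).
  move=> k l; exact: (smooth_connection Uopen _ smooth_III unit_III).
(* Differentiate [connection_III] for the index b in direction a, which is legitimate as it holds on
   all of [U], and isolate the derivative of the connection matrix. *)
have dT a b : pderivmx a (connection III b) x *m S x =
    pderivmx a (pderivmx b S) x + pderivmx a S x *m A b x
    + S x *m pderivmx a (A b) x - connection III b x *m pderivmx a S x.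
  apply/eqP; rewrite eq_sym subr_eq; apply/eqP.
  rewrite -(pderivmxM _ (smoothA' b) smoothS Ux).
  have -> : pderivmx a (fun y => connection III b y *m S y) x =
      pderivmx a (shape_deriv b) x.
    by apply: (pderivmx_eq_on Uopen) => // y; exact: connection_III.
  rewrite (pderivmxD _ (smooth_pderivmx _ smoothS)
    (smooth_mulmx Uopen smoothS (smoothA b)) Ux).
  by rewrite (pderivmxM _ smoothS (smoothA b) Ux) addrA.
apply: gauge_curvature (connection_III i Ux) (connection_III j Ux) (dT i j) _.
by rewrite dT (pderivmxC Uopen i j smoothS Ux).
Qed.

Hypothesis gauss : forall x, U x -> forall i j k l,
  riemann G i j k l x = H x i l * H x j k - H x i k * H x j l.

Lemma riemann_III x : U x -> forall i j k l,
  riemann III i j k l x = III x i l * III x j k - III x i k * III x j l.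
Proof.
move=> Ux i j k l.
(* The Gauss equation in matrix form: a difference of two rank-one matrices built from rows of H.
   Multiplying by S on the left and S^T on the right turns rows of H into rows of III. *)
have E : curvature G i j x *m G x =
    (row i (H x))^T *m row j (H x) - (row j (H x))^T *m row i (H x).
  apply/matrixP => a b; rewrite -riemannE gauss// !mxE !big_ord1 !mxE.
  by rewrite (mulrC (H x j a)).
have HS a : row a (H x) *m (S x)^T = row a (III x) by rewrite -row_mul -SG// IIIE.
have SH a : S x *m (row a (H x))^T = (row a (III x))^T.
  by rewrite -HS trmx_mul trmxK.
have EIII : curvature III i j x *m III x =
    (row i (III x))^T *m row j (III x) - (row j (III x))^T *m row i (III x).
  rewrite [in LHS]IIIE// !mulmxA curvature_III// -(mulmxA (S x)) E.
  by rewrite mulmxBr mulmxBl !mulmxA !SH -!mulmxA !HS.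
rewrite riemannE EIII !mxE !big_ord1 !mxE; ring.
Qed.

End ThirdFundamentalForm.

(** * Linear algebra of the third fundamental form *)

Lemma posdefmx_unit (R : realType) n (A : 'M[R]_n) : posdefmx A -> A \in unitmx.
Proof.
move=> pA; rewrite -row_free_unit -kermx_eq0; apply/rowV0P => v /sub_kermxP vA.
by apply/eqP/negPn/negP => /pA; rewrite vA mul0mx mxE ltxx.
Qed.

Lemma invmxM (F : comUnitRingType) n (A B : 'M[F]_n) :
  A \in unitmx -> B \in unitmx -> invmx (A *m B) = invmx B *m invmx A.
Proof.
move=> uA uB; have uAB : A *m B \in unitmx by rewrite unitmx_mul uA.
rewrite -[RHS](mulKmx uAB) -[LHS]mulmx1; congr (_ *m _).
by rewrite mulmxA mulmxK// mulmxV.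
Qed.

(** The tensor transformation law for h g^-1 h under a change of chart with Jacobian J: the inner
    factors J and J^T cancel against those of the inverse. *)
Lemma third_form_congruence (F : comUnitRingType) n (J g h : 'M[F]_n) :
  J \in unitmx -> g \in unitmx ->
  J *m h *m J^T *m invmx (J *m g *m J^T) *m (J *m h *m J^T) =
  J *m (h *m invmx g *m h) *m J^T.
Proof.
move=> uJ ug; have uJt : J^T \in unitmx by rewrite unitmx_tr.
by rewrite !invmxM ?unitmx_mul ?uJ// !mulmxA mulmxK// mulmxKV.
Qed.

(** The quadratic form at v is that of g at w = v h g^-1, and w is nonzero because h g^-1 is
    invertible. *)
Lemma posdefmx_third_form (R : realType) n (g h : 'M[R]_n) :
  g^T = g -> h^T = h -> posdefmx g -> posdefmx h ->
  posdefmx (h *m invmx g *m h).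
Proof.
move=> sg sh pg ph v v0; have ug := posdefmx_unit pg.
have uw : h *m invmx g \in unitmx.
  by rewrite unitmx_mul posdefmx_unit// unitmx_inv.
have w0 : v *m (h *m invmx g) != 0.
  by apply: contra_neq v0 => w0; rewrite -[v](mulmxK uw) w0 mul0mx.
suff -> : v *m (h *m invmx g *m h) *m v^T =
    v *m (h *m invmx g) *m g *m (v *m (h *m invmx g))^T by exact: pg.
by rewrite !trmx_mul trmx_inv sg sh !mulmxA mulmxKV.
Qed.

Lemma row_free_col_mx2 (F : fieldType) n (u v : 'rV[F]_n) (a b : F) :
  row_free (col_mx u v) -> a *: u + b *: v = 0 -> a = 0 /\ b = 0.
Proof.
move=> /row_free_inj fr ab.
have : row_mx a%:M b%:M = 0 :> 'rV[F]_(1 + 1).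
  by apply: fr; rewrite mul0mx mul_row_col !mul_scalar_mx.
rewrite -row_mx0 => /eq_row_mx[/matrixP/(_ 0 0) + /matrixP/(_ 0 0)].
by rewrite !mxE !eqxx.
Qed.

(** * From the curvature tensor to sectional curvature -1 *)

Section ConstantCurvature.
Variables (R : realType) (n : nat) (G : 'rV[R]_n -> 'M[R]_n) (x : 'rV[R]_n).
Hypotheses (symG : (G x)^T = G x) (posG : posdefmx (G x)).
Implicit Types u v : 'rV[R]_n.

Lemma innerE u v : inner G x u v = \sum_i (\sum_j G x i j * u 0 j) * v 0 i.
Proof.
rewrite /inner mxE; apply: eq_bigr => i _; rewrite !mxE; congr (_ * _).
by apply: eq_bigr => j _; rewrite mulrC -{1}symG mxE.
Qed.

Lemma innerC u v : inner G x u v = inner G x v u.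
Proof.
rewrite /inner; have -> : u *m G x *m v^T = (v *m G x *m u^T)^T.
  by rewrite !trmx_mul trmxK symG mulmxA.
by rewrite mxE.
Qed.

Lemma innerDZl a b u v w :
  inner G x (a *: u + b *: v) w = a * inner G x u w + b * inner G x v w.
Proof. by rewrite /inner !mulmxDl -!scalemxAl !mxE. Qed.

Lemma gram_neq0 u v : row_free (col_mx u v) ->
  inner G x u u * inner G x v v - inner G x u v ^+ 2 != 0.
Proof.
move=> fr; set q := inner G x u u; set s := inner G x u v.
have q0 : q != 0.
  rewrite gt_eqF//; apply: posG; apply/eqP => u0.
  have [/eqP] : 1 = 0 :> R /\ 0 = 0 :> R.
    by apply: (row_free_col_mx2 fr); rewrite u0 scaler0 scale0r addr0.
  by rewrite oner_eq0.
apply/eqP => gram0.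
(* This vector is q times the component of v orthogonal to u; its squared length is q times the Gram
   determinant, which gives strict Cauchy-Schwarz. *)
have w0 : - s *: u + q *: v != 0.
  by apply/eqP => /(row_free_col_mx2 fr)[_ /eqP]; rewrite (negbTE q0).
have := posG w0; rewrite -/(inner G x _ _) innerDZl ![inner G x _ (_ + _)]innerC.
rewrite !innerDZl -/q (innerC v u) -/s => wpos.
have : q * (q * inner G x v v - s ^+ 2) = 0 by rewrite gram0 mulr0.
by move: wpos; rewrite (_ : _ + _ = q * (q * inner G x v v - s ^+ 2));
  [move=> + E; rewrite E ltxx | ring].
Qed.

Lemma sectional_eqN1 u v :
  (forall i j k l, riemann G i j k l x = G x i l * G x j k - G x i k * G x j l) ->
  row_free (col_mx u v) -> sectional G x u v = -1.
Proof.
move=> riemannG fr; rewrite /sectional.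
(* [K w] is the covector dual to w. Contracting l, k, j, i in turn yields g(u,v)^2 - g(u,u) g(v,v),
   minus the denominator of [sectional]. *)
pose K (w : 'rV[R]_n) (i : 'I_n) : R := \sum_j G x i j * w 0 j.
have contract4 i j k : \sum_l riemann G i j k l x * u 0 i * v 0 j * u 0 k * v 0 l =
    K v i * u 0 i * v 0 j * (G x j k * u 0 k) - K v j * u 0 i * v 0 j * (G x i k * u 0 k).
  rewrite /K !mulr_suml -sumrB; apply: eq_bigr => l _.
  by rewrite riemannG; ring.
have contract3 i j : \sum_k \sum_l riemann G i j k l x * u 0 i * v 0 j * u 0 k * v 0 l =
    K v i * u 0 i * (K u j * v 0 j) - K u i * u 0 i * (K v j * v 0 j).
  under eq_bigr do rewrite contract4.
  rewrite sumrB -!mulr_sumr -/(K u i) -/(K u j); ring.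
rewrite (_ : \sum_i _ = inner G x u v ^+ 2 - inner G x u u * inner G x v v).
  by rewrite -opprB mulNr mulfV// gram_neq0.
under eq_bigr do under eq_bigr do rewrite contract3.
under eq_bigr do rewrite sumrB -!mulr_sumr.
by rewrite sumrB -!mulr_suml -!innerE (innerC v u) expr2.
Qed.

End ConstantCurvature.


(** * Assembly of the hyperbolic metric over the atlas *)

Theorem theorem1p2 (R : realType) (n : nat) (M : smooth_manifold R n)
    (g h : tensor2 M) :
  (4 <= n)%N ->
  compact [set: M]%classic ->
  spacelike g h ->
  positive_definite h ->
  exists g' : tensor2 M, hyperbolic g'.
Proof.
move=> _ _ [[symg posg] symh gaussgh codazzigh] posh.
(* Vectors being rows, the shape operator g^-1 h acts by right multiplication by h g^-1. *)
pose S a x := h a x *m invmx (g a x).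
pose III a x := S a x *m h a x.
have ug a x : chart_img (atlas a) x -> g a x \in unitmx.
  by move=> /posg; exact: posdefmx_unit.
have uh a x : chart_img (atlas a) x -> h a x \in unitmx.
  by move=> /posh; exact: posdefmx_unit.
have uS a x : chart_img (atlas a) x -> S a x \in unitmx.
  by move=> Ux; rewrite unitmx_mul uh// unitmx_inv ug.
have SG a x : chart_img (atlas a) x -> S a x *m g a x = h a x.
  by move=> Ux; rewrite mulmxKV// ug.
have IIIE a x : chart_img (atlas a) x ->
    III a x = S a x *m g a x *m (S a x)^T.
  by move=> Ux; rewrite SG// trmx_mul trmx_inv symg// symh// mulmxA.
have open_img (a : chart_index M) : open (chart_img (atlas a)) by exact: chart_img_open.
have smooth_g a : smooth_mx_on (chart_img (atlas a)) (g a).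
  by move=> i j; exact: comp_smooth.
have smooth_h a : smooth_mx_on (chart_img (atlas a)) (h a).
  by move=> i j; exact: comp_smooth.
have smooth_S a : smooth_mx_on (chart_img (atlas a)) (S a).
  apply: smooth_mulmx => //; apply: smooth_invmx => //; exact: ug.
have smoothIII a i j : smooth_on (chart_img (atlas a)) (fun x => III a x i j).
  exact: smooth_mulmx.
have III_change a b x : overlap (atlas a) (atlas b) x ->
    let psi := transition (atlas a) (atlas b) in
    III a x = 'J psi x *m III b (psi x) *m ('J psi x)^T.
  move=> Oab psi.
  have Ux : chart_img (atlas a) x by case: Oab => p [ap _] <-; exists p.
  have Upsi : chart_img (atlas b) (psi x).
    case: Oab => p [ap bp] <-; exists p => //.
    by rewrite /psi /transition /= chart_mapK// inE.
  (* The Jacobian is invertible because it is a factor of the invertible matrix [g a x], by the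
     transformation law of g. *)
  have := ug a x Ux; rewrite /III /S !(comp_change _ Oab) -/psi.
  rewrite !unitmx_mul unitmx_tr => /andP[/andP[uJ ugb] _].
  exact: third_form_congruence.
pose g' := Tensor2 smoothIII III_change.
have symIII a x : chart_img (atlas a) x -> (III a x)^T = III a x.
  exact: trmx_III (symg a) (IIIE a) x.
have posIII a x : chart_img (atlas a) x -> posdefmx (III a x).
  move=> Ux; apply: posdefmx_third_form; [exact: symg|exact: symh|exact: posg|].
  exact: posh.
exists g'; split; first by split.
exists (-1) => [|a x Ux u v fr]; first by rewrite ltrN10.
apply: sectional_eqN1 => //; [exact: symIII|exact: posIII|].
have codazzia y : chart_img (atlas a) y -> forall i j k,
    cov_deriv (g a) (h a) i j k y = cov_deriv (g a) (h a) j i k y.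
  by move=> Uy i j k; apply: subr0_eq; exact: codazzigh.
have gaussa y : chart_img (atlas a) y -> forall i j k l,
    riemann (g a) i j k l y = h a y i l * h a y j k - h a y i k * h a y j l.
  by move=> Uy i j k l; apply: subr0_eq; exact: gaussgh.
exact: (riemann_III (open_img a) (smooth_g a) (smooth_S a) (symg a) (ug a) (uS a)
  (SG a) (IIIE a) codazzia gaussa Ux).
Qed.
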